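(* Let $G$ be an even-linked graph of order $n$, let $C$ and $C'$ be the unique odd cycles of $G$, and let $X$ be the set of vertices in $V(C)\cup V(C')$ having degree $2$ in $G$. Then $G-X$ is a graph with bipartition $(A,B)$ such that $|A|=|B|+1$. Moreover, $\mathrm{core}(G)=B$, $\alpha(G)=\frac{n-1}{2}$, and $|\mathrm{core}(G)|=\frac{n-|V(C)\cup V(C')|+1}{2}$.
   Context: All graphs are finite, simple and undirected. $\alpha(G)$ is the maximum size of an independent set of $G$, and $\mathrm{core}(G)$ is the intersection of all maximum independent sets of $G$. A graph $G$ is $2$-bicritical if $|N(S)|>|S|$ for every nonempty independent set $S\subseteq V(G)$, where $N(S)=\bigcup_{v\in S}N(v)$. Let $H$ be a subgraph of $G$. An ear with respect to $H$ is an odd-length path whose endpoints lie in $H$ and whose internal vertices are distinct and lie outside $H$. A pendant with respect to $H$ is an odd cycle $D$, vertex-disjoint from $H$, together with a simple path of positive length with one end in $D$ and the other in $H$, all of whose other vertices lie outside both $H$ and $D$. A connected $2$-bicritical graph $G$ with exactly two odd cycles (counted as subgraphs) is an even-linked graph if there is a sequence $G_0,G_1,\dots,G_p=G$ such that $G_0$ is an odd cycle, $G_1$ is obtained from $G_0$ by adding a pendant, $G_i$ is obtained from $G_{i-1}$ by adding an ear for $i=2,\dots,p$, and the path of $G_1$ that connects its two odd cycles has even length. *)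

(* Defs.v *)
From HB Require Import structures.
From mathcomp Require Import all_boot all_order all_algebra.

Set Implicit Arguments.
Unset Strict Implicit.
Unset Printing Implicit Defensive.

(* A finite simple undirected graph on the vertex set T is a symmetric and    *)
(* irreflexive relation e : rel T (both assumed where needed).                *)
Section Graphs.

Variables (T : finType) (e : rel T).

Definition open_nbhd (x : T) : {set T} := [set y | e x y].

Definition nbhd (S : {set T}) : {set T} := \bigcup_(x in S) open_nbhd x.

Definition degree (x : T) : nat := #|open_nbhd x|.

Definition independent (S : {set T}) : bool :=
  [forall x in S, forall y in S, ~~ e x y].

Definition alpha : nat := \max_(S : {set T} | independent S) #|S|.

Definition core : {set T} :=
  \bigcap_(S : {set T} | independent S && (#|S| == alpha)) S.

Definition two_bicritical : Prop :=
  forall S : {set T}, S != set0 -> independent S -> #|S| < #|nbhd S|.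

Definition connected_graph : Prop := forall x y : T, connect e x y.

(* (A, B) is a bipartition of the subgraph of (T, e) induced by U. *)
Definition bipartition (U A B : {set T}) : Prop :=
  [/\ A :|: B = U, [disjoint A & B], independent A & independent B].

(* Edges are unordered pairs, so that subgraphs with the same vertices and    *)
(* edges are equal: a cycle does not depend on a starting point or direction. *)
Record subgraph : Type := Subgraph {
  vertices : {set T};
  edges : {set {set T}}
}.

Definition subgraph_union (H K : subgraph) : subgraph :=
  Subgraph (vertices H :|: vertices K) (edges H :|: edges K).

Definition whole_graph : subgraph :=
  Subgraph [set: T] [set [set xy.1; xy.2] | xy : T * T & e xy.1 xy.2].

Definition path_subgraph (x : T) (p : seq T) : subgraph :=
  Subgraph [set y in x :: p] [set [set yz.1; yz.2] | yz in zip (x :: p) p].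

Definition cycle_subgraph (c : seq T) : subgraph :=
  Subgraph [set x in c] [set [set x; next c x] | x in c].

Definition odd_cycle_seq (c : seq T) : Prop :=
  [/\ cycle e c, uniq c, 2 < size c & odd (size c)].

Definition odd_cycle (C : subgraph) : Prop :=
  exists2 c : seq T, odd_cycle_seq c & C = cycle_subgraph c.

Definition exactly_two_odd_cycles : Prop :=
  exists C C' : subgraph,
    C <> C' /\ (forall D : subgraph, odd_cycle D <-> D = C \/ D = C').

(* An ear with endpoints x, y and internal vertices q; its length is          *)
(* size (rcons q y).  The endpoints x and y are allowed to coincide.          *)
Definition ear (H : subgraph) (x : T) (q : seq T) (y : T) : Prop :=
  [/\ path e x (rcons q y), odd (size (rcons q y)),
      x \in vertices H, y \in vertices H &
      uniq q /\ {in q, forall z, z \notin vertices H}].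

Definition add_ear (H H' : subgraph) : Prop :=
  exists (x : T) (q : seq T) (y : T),
    ear H x q y /\ H' = subgraph_union H (path_subgraph x (rcons q y)).

(* A pendant: the odd cycle D and the path from x in D to y in H with         *)
(* internal vertices q, whose length size (rcons q y) is positive.            *)
Definition pendant (H D : subgraph) (x : T) (q : seq T) (y : T) : Prop :=
  [/\ odd_cycle D, [disjoint vertices D & vertices H],
      path e x (rcons q y) /\ uniq (x :: rcons q y),
      x \in vertices D /\ y \in vertices H &
      {in q, forall z, (z \notin vertices H) && (z \notin vertices D)}].

(* When H is a cycle, the path of H' between its two cycles is the path of    *)
(* the pendant, so its parity is imposed here.                                *)
Definition add_even_pendant (H H' : subgraph) : Prop :=
  exists (D : subgraph) (x : T) (q : seq T) (y : T),
    [/\ pendant H D x q y,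
        ~~ odd (size (rcons q y)) &
        H' = subgraph_union H
               (subgraph_union D (path_subgraph x (rcons q y)))].

Definition even_linked : Prop :=
  [/\ connected_graph, two_bicritical, exactly_two_odd_cycles &
      exists (p : nat) (Gs : nat -> subgraph),
        [/\ 0 < p, odd_cycle (Gs 0), add_even_pendant (Gs 0) (Gs 1),
            (forall i, 1 < i <= p -> add_ear (Gs i.-1) (Gs i)) &
            Gs p = whole_graph]].

End Graphs.

(* Main.v *)
Require Import Defs.
From HB Require Import structures.
From mathcomp Require Import all_boot all_order all_algebra zify.

Set Implicit Arguments.
Unset Strict Implicit.
Unset Printing Implicit Defensive.

(* Only the two disjoint odd cycles, the even path between them and           *)
(* 2-bicriticality matter; the ears are never used.  An ear on an odd cycle C *)
(* closes up with one of the two arcs of C to a further odd cycle, so all     *)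
(* edges leaving C start at the end a of the path: a component of G - C       *)
(* attached to C elsewhere would be bipartite, and applying |N(S)| > |S| to   *)
(* its two sides is contradictory.  Hence X is C and C' without a and a', and *)
(* G - X is connected and bipartite with a, a' on the same side A.            *)
(* 2-bicriticality of B and of A0 = A - {a, a'} gives |A0| < |B| < |A|, hence *)
(* |A| = |B| + 1.  Every independent S satisfies 2|S| < n since N(S) misses   *)
(* S, and B with alternate vertices of the paths C - a and C' - a' attains    *)
(* (n - 1)/2; the two alternating choices show core(G) <= B.  Conversely, a   *)
(* maximum S has at most (|C| - 1)/2 and (|C'| - 1)/2 vertices in C and C',   *)
(* so at least |B| in A0 and B together; if S met A0, then                    *)
(* |S /\ A0| < |N(S /\ A0)| <= |B - S| would contradict this.                 *)

(** Three mechanisms carry the argument. Parity: an odd closed walk contains an odd cycle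
    ([odd_closed_walk]), so in a vertex set without odd cycles the vertices reached from a base
    vertex by even and by odd walks form two disjoint independent sets ([reach_disjoint],
    [reach_indep]). This produces the two classes of the branch excluded in [cycle_nbhd] as well as
    the final [A] and [B]. Rigidity: [cycle_ear] turns a detour between two vertices of an odd cycle
    into an odd cycle, and having only two odd cycles, which are disjoint, then forbids chords and
    second attachments ([no_chord], [no_ear]). Thus each cycle meets the rest of the graph only at
    its end of the linking path, which identifies [X] ([degree_cycle]). Counting:
    [two_bicritical_bound] bounds independent sets globally, [independent_cycle] bounds them on each
    odd cycle, and [alternating_cycle] shows that the bounds are attained in two disjoint ways.
    [even_link_structure] combines these. *)

Section Walks.

Variables (T : finType) (e : rel T).

(** * Odd closed walks, and the two parity classes of a region without odd cycles *)

Lemma not_uniq_split (c : seq T) : ~~ uniq c ->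
  exists p1 x p2 p3, c = p1 ++ x :: p2 ++ x :: p3.
Proof.
elim: c => //= x c IHc; rewrite negb_and negbK.
case: (boolP (x \in c)) => [/splitPr[p2 p3] _ | _ /= /IHc [p1 [y [p2 [p3 ->]]]]].
  by exists [::], x, p2, p3.
by exists (x :: p1), y, p2, p3.
Qed.

(** By induction on the length: a repeated vertex cuts the walk into two shorter closed walks, one
    of which is odd. *)
Lemma odd_closed_walk (c : seq T) : irreflexive e -> cycle e c -> odd (size c) ->
  exists2 d, odd_cycle_seq e d & {subset d <= c}.
Proof.
move=> e_irr; have [n] := ubnP (size c).
elim: n c => // n IHn c le_c cyc_c odd_c.
case: (boolP (uniq c)) => [uniq_c | /not_uniq_split[p1 [x [p2 [p3 def_c]]]]].
  exists c => //; split=> //.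
  by case: c cyc_c odd_c {le_c uniq_c} => [|x [|y [|z c]]] //=; rewrite e_irr.
have rot_c : rot (size p1) c = (x :: p2) ++ x :: p3 ++ p1.
  by rewrite def_c rot_size_cat /= -catA.
have size_c : size c = size (x :: p2) + size (x :: p3 ++ p1).
  by rewrite -(size_rot (size p1)) rot_c size_cat.
have sub_c d : {subset d <= (x :: p2) ++ x :: p3 ++ p1} -> {subset d <= c}.
  by rewrite -rot_c => sub_d y /sub_d; rewrite mem_rot.
move: cyc_c; rewrite -(rot_cycle (size p1)) rot_c /=.
rewrite rcons_cat rcons_cons -cat_rcons cat_path last_rcons.
case/andP=> cyc2 cyc3; move: odd_c; rewrite size_c oddD.
case: (boolP (odd (size (x :: p2)))) => [odd2 _ | _ odd3].
  have [|d dP sub_d] := IHn (x :: p2) _ cyc2 odd2.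
    by move: le_c; rewrite size_c /=; lia.
  by exists d => //; apply: sub_c => y /sub_d yp; rewrite mem_cat yp.
have [|d dP sub_d] := IHn (x :: p3 ++ p1) _ cyc3 odd3.
  by move: le_c; rewrite size_c /=; lia.
by exists d => //; apply: sub_c => y /sub_d yp; rewrite mem_cat yp orbT.
Qed.

Lemma connect_inv (S : finType) (r : rel S) (P : S -> Prop) x y :
  (forall u v, r u v -> P u -> P v) -> P x -> connect r x y -> P y.
Proof.
move=> rP Px /connectP[p rp ->{y}].
by elim: p x Px rp => //= z p IHp x Px /andP[/rP/(_ Px)/IHp].
Qed.

(* Walks inside [U] in the bipartite double cover of the graph: the boolean   *)
(* component is the parity of the length of the walk.                         *)
Definition cover_step (U : {set T}) : rel (T * bool) :=
  [rel a b | [&& e a.1 b.1, a.1 \in U, b.1 \in U & b.2 == ~~ a.2]].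

Definition reach (U : {set T}) (s : T) (b : bool) : {set T} :=
  [set v | connect (cover_step U) (s, false) (v, b)].

Lemma cover_path (U : {set T}) x b p : path (cover_step U) (x, b) p ->
  [/\ path e x (map fst p), {subset map fst p <= U} &
      (last (x, b) p).2 = b (+) odd (size p)].
Proof.
elim: p x b => [|[y c] p IHp] x b /=; first by rewrite addbF.
case/andP=> /and4P[/= -> _ Uy /eqP->] /IHp[-> sub_p ->]; split=> //.
  by move=> z; rewrite inE => /predU1P[-> // | /sub_p].
by rewrite addNb addbN.
Qed.

Lemma reach0 (U : {set T}) s : s \in reach U s false.
Proof. by rewrite inE connect0. Qed.

Lemma reach_sub (U : {set T}) s b : s \in U -> reach U s b \subset U.
Proof.
move=> Us; apply/subsetP=> v; rewrite inE.
by apply: (@connect_inv _ _ (fun a => a.1 \in U)) => // a a' /and4P[].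
Qed.

Lemma reach_step (U : {set T}) s b v w :
  s \in U -> v \in reach U s b -> w \in U -> e v w -> w \in reach U s (~~ b).
Proof.
move=> Us vb Uw evw; have Uv := subsetP (reach_sub b Us) v vb.
move: vb; rewrite !inE => /connect_trans; apply; apply: connect1.
by apply/and4P; split=> /=.
Qed.

Hypotheses (e_sym : symmetric e) (e_irr : irreflexive e).

(** A vertex [v] in both classes gives a walk from [(v, false)] to [(v, true)] through [(s, false)],
    that is, an odd closed walk inside [U], which contains an odd cycle. *)
Lemma reach_disjoint (U : {set T}) s : s \in U ->
    (forall d, odd_cycle_seq e d -> {subset d <= U} -> False) ->
  [disjoint reach U s false & reach U s true].
Proof.
move=> Us noodd; apply/pred0P=> v /=; apply: contraFF (erefl false); rewrite !inE.
have csym : connect_sym (cover_step U).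
  apply: sym_connect_sym => -[x b] [y c]; rewrite /cover_step /= e_sym.
  by case: b; case: c; case: (x \in U); case: (y \in U).
rewrite csym => /andP[vs sv].
have /connectP[p /cover_path[ep sub_p par_p] last_p] := connect_trans vs sv.
move: par_p; rewrite -last_p /= => odd_p.
have lastv : last v (map fst p) = v by rewrite -[v in LHS]/((v, false).1) last_map -last_p.
have: odd (size (map fst p)) by rewrite size_map.
case/lastP: (map fst p) ep sub_p lastv => // p' v' ep sub_p.
rewrite last_rcons => def_v; rewrite {}def_v in ep sub_p *.
rewrite size_rcons => odd_p'.
have [//|d /noodd dP sub_d] := @odd_closed_walk (v :: p') e_irr ep.
exfalso; apply: dP => y /sub_d.
by rewrite -mem_rcons => /sub_p.
Qed.

Lemma reach_indep (U : {set T}) s b : s \in U ->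
    [disjoint reach U s false & reach U s true] ->
  independent e (reach U s b).
Proof.
move=> Us dis; apply/forall_inP=> x xb; apply/forall_inP=> y yb.
apply/negP=> exy; have Uy := subsetP (reach_sub b Us) y yb.
have yNb := reach_step Us xb Uy exy.
move=> {xb}; case: b yb yNb => /= yb yNb.
  by rewrite (disjointFr dis yNb) in yb.
by rewrite (disjointFr dis yb) in yNb.
Qed.

Lemma nbhd_sub (S R : {set T}) :
  (forall x y, x \in S -> e x y -> y \in R) -> nbhd e S \subset R.
Proof. by move=> SR; apply/bigcupsP=> x Sx; apply/subsetP=> y; rewrite inE; apply: SR. Qed.

Lemma independentS (S R : {set T}) :
  S \subset R -> independent e R -> independent e S.
Proof.
move=> /subsetP sSR /forall_inP iR; apply/forall_inP=> x /sSR/iR/forall_inP ix.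
by apply/forall_inP=> y /sSR/ix.
Qed.

Lemma independentP (S : {set T}) :
  reflect (forall x y, x \in S -> y \in S -> e x y -> False) (independent e S).
Proof.
apply: (iffP forall_inP) => [iS x y Sx Sy|iS x Sx].
  by apply/negP; have/forall_inP := iS x Sx; apply.
by apply/forall_inP=> y Sy; apply/negP; apply: iS.
Qed.

End Walks.

(** * Rerouting an odd cycle along an ear *)

Section Cycles.

Variables (T : finType) (e : rel T).
Hypotheses (e_sym : symmetric e) (e_irr : irreflexive e).

Lemma odd_cycle_rot i c : odd_cycle_seq e c -> odd_cycle_seq e (rot i c).
Proof. by case=> ? ? ? ?; split; rewrite ?rot_cycle ?rot_uniq ?size_rot. Qed.

(* [q] together with one of the two arcs of [c] between [u] and [v], chosen   *)
(* by parity, is an odd cycle; it omits the interior of the other arc.        *)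
Lemma cycle_ear c u v q :
    odd_cycle_seq e c -> u \in c -> v \in c -> u != v ->
    path e u (rcons q v) -> uniq q -> {in q, forall z, z \notin c} ->
  exists2 d, odd_cycle_seq e d &
    [/\ u \in d, {subset q <= d} &
        [\/ v = next c u, u = next c v | exists2 w, w \in c & w \notin d]].
Proof.
move=> oc uc vc uv; have [_ uniq_c _ _] := oc.
case: (rot_to_arc uniq_c uc vc uv) => i s1 s2 _ _ def_c.
have := odd_cycle_rot i oc.
have nextE w : next c w = next (rot i c) w by rewrite next_rot.
have memE w : (w \in c) = (w \in rot i c) by rewrite mem_rot.
rewrite def_c => -[cyc uniq_rc _ odd_rc] path_q uniq_q q_c.
have{}q_c w : w \in q -> w \notin u :: s1 ++ v :: s2 by rewrite -def_c mem_rot; apply: q_c.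
move: cyc; rewrite /= rcons_cat rcons_cons -cat_rcons cat_path last_rcons.
case/andP=> path1 path2.
move: odd_rc; rewrite /= size_cat /= addnS /= negbK oddD => odd_rc.
move: (uniq_rc); rewrite /= mem_cat inE cat_uniq /= !negb_or.
case/and5P=> /and3P[us1 _ us2] uniq1 /andP[vs1 /hasPn s12] vs2 uniq2.
(* Since [c] is odd, its arc interiors [s1] and [s2] have lengths of opposite parity, so exactly one
   of them closes up with [q] to an odd cycle. If the discarded interior is empty, [u] and [v] are
   consecutive on [c]. *)
case: (boolP (odd (size q + size s2))) => par.
  exists (u :: q ++ v :: s2); last split.
  - split.
    + by rewrite /= rcons_cat rcons_cons -cat_rcons cat_path last_rcons path_q.
    + rewrite /= cat_uniq /= uniq_q vs2 uniq2 mem_cat inE !negb_or us2 uv /= !andbT.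
      have ->: u \notin q by apply/negP=> /q_c; rewrite inE eqxx.
      rewrite /=; apply/andP; split; first by apply/negP=> /q_c; rewrite inE mem_cat inE eqxx !orbT.
      by apply/hasPn=> w ws2; apply/negP=> /q_c; rewrite inE mem_cat inE ws2 !orbT.
    + by rewrite /= size_cat /= addnS; case: (size q + _) par.
    + by rewrite /= size_cat /= addnS /= negbK.
  - by rewrite inE eqxx.
  - by move=> w wq; rewrite inE mem_cat wq orbT.
  - case: s1 {path1 odd_rc uniq_rc} => [|w s1] in us1 uniq1 vs1 s12 def_c memE q_c *.
      by apply: Or31; rewrite nextE def_c /= eqxx.
    apply: Or33; exists w; first by rewrite memE def_c inE mem_cat inE eqxx !orbT.
    have w1 : w \in w :: s1 by rewrite inE eqxx.
    apply/negP; rewrite inE mem_cat inE => /or4P[/eqP wu | /q_c | /eqP wv | /s12].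
    - by rewrite -wu w1 in us1.
    - by rewrite inE mem_cat w1 orbT.
    - by rewrite -wv w1 in vs1.
    - by rewrite w1.
exists (u :: s1 ++ v :: rev q); last split.
- have q_path : path e v (rcons (rev q) u).
    have := rev_path e u (rcons q v).
    rewrite last_rcons belast_rcons rev_cons => ->.
    by rewrite (@eq_path _ _ e) // => x y; apply: e_sym.
  split.
  + by rewrite /= rcons_cat rcons_cons -cat_rcons cat_path last_rcons path1.
  + rewrite /= cat_uniq /= rev_uniq uniq_q uniq1 mem_cat inE mem_rev !negb_or us1 uv /=.
    rewrite (negPf vs1) andbT !mem_rev.
    apply/and3P; split.
    * by apply/negP=> /q_c; rewrite inE eqxx.
    * by apply/hasPn=> w; rewrite mem_rev => /q_c; rewrite inE mem_cat !negb_or => /and3P[].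
    * by apply/negP=> /q_c; rewrite inE mem_cat inE eqxx !orbT.
  + rewrite /= size_cat /= size_rev addnS; move: odd_rc par; rewrite oddD.
    by case: (s1) => // ; case: (q) => //= ; case: (odd _).
  + move: odd_rc par; rewrite /= size_cat /= size_rev addnS /= negbK !oddD.
    by case: (odd (size s1)); case: (odd (size s2)); case: (odd _).
- by rewrite inE eqxx.
- by move=> w wq; rewrite inE mem_cat inE mem_rev wq !orbT.
- case: s2 {path2 odd_rc par} => [|w s2] in uniq_rc us2 uniq2 vs2 s12 def_c memE q_c *.
    apply: Or32; rewrite nextE def_c.
    have rotE : rot (size (u :: s1)) (u :: s1 ++ [:: v]) = v :: u :: s1.
      exact: (rot_size_cat (u :: s1) [:: v]).
    by rewrite -(next_rot (size (u :: s1))) // rotE /= eqxx.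
  apply: Or33; exists w; first by rewrite memE def_c inE mem_cat !inE eqxx !orbT.
  have w2 : w \in w :: s2 by rewrite inE eqxx.
  apply/negP; rewrite inE mem_cat inE mem_rev => /or4P[/eqP wu | w1 | /eqP wv | /q_c].
  - by rewrite -wu w2 in us2.
  - by have := s12 w w2; rewrite w1.
  - by rewrite -wv w2 in vs2.
  - by rewrite inE mem_cat inE w2 !orbT.
Qed.

Lemma next_neq_prev (c : seq T) x : uniq c -> 2 < size c -> x \in c -> next c x != prev c x.
Proof.
move=> uniq_c size_c xc; have [i s def_c] := rot_to xc.
rewrite -(next_rot i) // -(prev_rot i) //.
move: uniq_c size_c; rewrite -(rot_uniq i) -(size_rot i) def_c => uniq_c.
case: s {def_c} uniq_c => [|y [|z s]] // uniq_c _.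
apply/eqP=> nextE; have := next_prev uniq_c x; rewrite -{}nextE /= !eqxx.
move: uniq_c; rewrite /= !inE !negb_or => /and3P[/and3P[xy xz _] /andP[yz _] _].
by rewrite eq_sym (negPf xy) => zx; rewrite zx eqxx in xz.
Qed.
End Cycles.

(** * An odd cycle meets the rest of the graph only at the end [a] of the linking path *)

Section Attachment.

Variables (T : finType) (e : rel T).
Hypotheses (e_sym : symmetric e) (e_irr : irreflexive e).

Definition avoid (c : seq T) : rel T :=
  [rel u v | [&& e u v, u \notin c & v \notin c]].

Lemma avoid_sym c : connect_sym (avoid c).
Proof.
by apply: sym_connect_sym => u v; rewrite /avoid /= e_sym [X in _ && X]andbC.
Qed.

Lemma avoid_path c u p : u \notin c -> path (avoid c) u p ->
  path e u p /\ {in u :: p, forall z, z \notin c}.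
Proof.
elim: p u => [|v p IHp] u uc /=; first by split=> // z; rewrite inE => /eqP->.
case/andP=> /and3P[/= euv _ vc] /(IHp v vc)[ep pc]; rewrite euv; split=> // z.
by rewrite inE => /predU1P[-> // | /pc].
Qed.

Lemma path_avoid c u p : path e u p -> {in u :: p, forall z, z \notin c} ->
  path (avoid c) u p.
Proof.
elim: p u => //= v p IHp u /andP[euv ep] upc.
rewrite /avoid /= euv !upc ?inE ?eqxx ?orbT //=.
by apply: IHp => // z zp; apply: upc; rewrite inE zp orbT.
Qed.

Variables (c c' : seq T) (a p1 : T).
Hypotheses (odd_c : odd_cycle_seq e c) (odd_c' : odd_cycle_seq e c').
Hypothesis dis_c : {in c, forall x, x \notin c'}.
Hypothesis two_cycles : forall d, odd_cycle_seq e d -> d =i c \/ d =i c'.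

(** The ear from [u] through [z] to [v] closes up to an odd cycle containing both [z], so it is not
    [c], and [u], so it is not [c']. *)
Lemma no_ear u v z w : u \in c -> v \in c -> u != v -> e u z -> e v w ->
  z \notin c -> connect (avoid c) z w -> False.
Proof.
move=> uc vc uv euz evw zc /connectP[p /shortenP[q path_q uniq_q _] def_w].
have [eq qc] := avoid_path zc path_q.
have [|d od [ud qd _]] := @cycle_ear _ _ e_sym c u v (z :: q) odd_c uc vc uv _ uniq_q qc.
  by rewrite /= rcons_path euz eq -def_w e_sym.
have zd : z \in d by apply: qd; rewrite inE eqxx.
case: (two_cycles od) => def_d; first by rewrite -def_d zd in zc.
by have := dis_c uc; rewrite -def_d ud.
Qed.

Lemma no_chord u v : u \in c -> v \in c -> e u v -> v = next c u \/ u = next c v.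
Proof.
move=> uc vc euv; have uv : u != v by apply: contraTneq euv => ->; rewrite e_irr.
have [|//|d od [ud _ dP]] := @cycle_ear _ _ e_sym c u v [::] odd_c uc vc uv _ isT.
  by rewrite /= euv.
case: dP => [->|->|[w wc wd]]; [by left | by right | exfalso].
case: (two_cycles od) => def_d; first by rewrite def_d wc in wd.
by have := dis_c uc; rewrite -def_d ud.
Qed.

Hypotheses (ac : a \in c) (p1c : p1 \notin c) (eap1 : e a p1).
Hypothesis conn_c' : {in c', forall w, connect (avoid c) p1 w}.
Hypothesis bicrit : two_bicritical e.

(* Otherwise the branch hanging at [x] is bipartite, and 2-bicriticality of   *)
(* its two colour classes is contradictory.                                   *)
Lemma cycle_nbhd x z : x \in c -> x != a -> e x z -> z \in c.
Proof.
move=> xc xa exz; apply/idPn=> zc.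
pose K := [set v | connect (avoid c) z v]; pose U := x |: K.
have Kc v : v \in K -> v \notin c.
  by rewrite inE; apply: (@connect_inv _ _ (fun v => v \notin c)) => // ? ? /and3P[].
(* A branch at [x] reaching [c'] would be joined outside [c] to [p1], the neighbour of [a], giving
   an ear from [x] to [a]. *)
have Kc' v : v \in K -> v \notin c'.
  rewrite inE => zv; apply/negP=> vc'; apply: (@no_ear x a z p1) => //.
  by apply: connect_trans zv _; rewrite avoid_sym; apply: conn_c'.
(* By [no_ear] again, the branch is attached to [c] at [x] alone. *)
have KU v w : v \in K -> e v w -> w \in U.
  move=> vK evw; rewrite !inE; have vc := Kc v vK.
  case: (boolP (w \in c)) => wc; last first.
    apply/orP; right; move: vK; rewrite inE => /connect_trans; apply.
    by apply: connect1; apply/and3P.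
  case: eqVneq => //= wx; exfalso; apply: (@no_ear x w z v) => //.
  - by rewrite eq_sym.
  - by rewrite e_sym.
  - by rewrite inE in vK.
have xU : x \in U by rewrite !inE eqxx.
have xc' := dis_c xc.
have noodd d : odd_cycle_seq e d -> {subset d <= U} -> False.
  move=> od dU; case: (two_cycles od) => def_d.
    have ad : a \in d by rewrite def_d.
    have /setU1P[ax|/Kc] := dU a ad; first by rewrite ax eqxx in xa.
    by rewrite ac.
  have [_ _ size_c' _] := odd_c'.
  case: (c') def_d Kc' size_c' xc' => // y s def_d Kc' _ xc'.
  have yc : y \in y :: s by rewrite inE eqxx.
  have /setU1P[yx|/Kc'] := dU y (etrans (def_d y) yc); first by rewrite -yx yc in xc'.
  by rewrite yc.
pose L := reach e U x false; pose R := reach e U x true.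
have dis := reach_disjoint e_sym e_irr xU noodd.
have indL := reach_indep false xU dis.
have indR := reach_indep true xU dis.
have xL : x \in L := reach0 e U x.
have Kmem v b : v \in reach e U x b -> v != x -> v \in K.
  by move=> /(subsetP (reach_sub e b xU)) /setU1P[->|//]; rewrite eqxx.
have zR : z \in R.
  by apply: (reach_step xU xL) => //; rewrite !inE connect0 orbT.
(* Only [x] can have neighbours outside [U], and it lies in [L]. Hence the neighbours of [R] lie in
   [L] and those of [L :\ x] in [R]; the two strict inequalities are incompatible because [L] has
   just one vertex more than [L :\ x]. *)
have ltRL : #|R| < #|L|.
  apply: leq_trans (bicrit _ indR) _; first by apply/set0Pn; exists z.
  apply/subset_leq_card/nbhd_sub => v w vR evw.
  apply: (reach_step xU vR) => //; apply: KU evw; apply: (Kmem v true) => //.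
  by apply: contraTneq vR => ->; rewrite (disjointFr dis xL).
have leLR : #|L :\ x| < #|R|.
  case: (set_0Vmem (L :\ x)) => [->|[v vL]].
    by rewrite cards0; apply/card_gt0P; exists z.
  have indLx : independent e (L :\ x) by apply: independentS indL; apply: subsetDl.
  apply: leq_trans (bicrit _ indLx) _; first by apply/set0Pn; exists v.
  apply/subset_leq_card/nbhd_sub => {v vL} v w /setD1P[vx vL] evw.
  by apply: (reach_step xU vL) => //; apply: KU evw; apply: (Kmem v false).
by rewrite (cardsD1 x L) xL add1n ltnS leqNgt leLR in ltRL.
Qed.

Lemma cycle_nbhdE x : x \in c -> x != a -> open_nbhd e x = [set next c x; prev c x].
Proof.
have [cyc_c uniq_c _ _] := odd_c.
move=> xc xa; apply/setP=> y; rewrite !inE; apply/idP/orP=> [exy | [/eqP->|/eqP->]].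
- have yc := cycle_nbhd xc xa exy.
  case: (no_chord xc yc exy) => [->|->]; first by left.
  by right; rewrite prev_next.
- exact: next_cycle.
- by rewrite e_sym prev_cycle.
Qed.

(** Off [a] the neighbours are the two cycle neighbours, while [a] also has the neighbour [p1]
    outside [c]. *)
Lemma degree_cycle x : x \in c -> (degree e x == 2) = (x != a).
Proof.
have [cyc_c uniq_c size_c _] := odd_c.
move=> xc; case: (eqVneq x a) => [{x xc}-> | xa] /=; last first.
  by rewrite /degree cycle_nbhdE // cards2 next_neq_prev.
apply: gtn_eqF; have <-: #|p1 |: [set next c a; prev c a]| = 3.
  rewrite cardsU1 cards2 next_neq_prev // !inE.
  case: eqVneq => [p1E|_]; first by move: p1c; rewrite p1E mem_next ac.
  by case: eqVneq => [p1E|_] //; move: p1c; rewrite p1E mem_prev ac.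
apply/subset_leq_card/subsetP=> y; rewrite !inE.
case/or3P=> /eqP->//; first exact: next_cycle.
by rewrite e_sym prev_cycle.
Qed.

End Attachment.

(** * Independent sets on an odd cycle *)

Section Alternating.

Variables (T : finType) (e : rel T).

(** The part of [S] on the cycle and its shift by [next] are disjoint and of equal size, and
    together they cannot fill an odd number of vertices. *)
Lemma independent_cycle (c : seq T) (S : {set T}) :
  odd_cycle_seq e c -> independent e S -> (#|S :&: [set x in c]|).*2 < size c.
Proof.
move=> [cyc_c uniq_c size_c odd_c] /independentP indS.
have card_c : #|[set x in c]| = size c by rewrite cardsE; apply/card_uniqP.
set I := S :&: _.
have injn : injective (next c) by apply: can_inj (prev_next uniq_c).
have dis : [disjoint I & next c @: I].
  apply/pred0P=> x /=; apply/negP=> /andP[/setIP[xS _] /imsetP[y /setIP[yS yc] def_x]].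
  rewrite inE in yc.
  by apply: (indS y x) => //; rewrite def_x next_cycle.
have sub : I :|: next c @: I \subset [set x in c].
  rewrite subUset subsetIr; apply/subsetP=> x /imsetP[y /setIP[_ yc] ->].
  by rewrite inE in yc; rewrite inE mem_next.
have := subset_leq_card sub; rewrite card_c cardsU disjoint_setI0 // cards0 subn0.
rewrite card_imset // addnn leq_eqVlt => /predU1P[def_c|//].
by rewrite -def_c odd_double in odd_c.
Qed.

(** The sets are the positions of either parity along the path left by removing [a]. Each has at
    most half of the remaining vertices by [independent_cycle], and together they have all of them,
    so both have exactly half. *)
Lemma alternating_cycle (c : seq T) a :
    odd_cycle_seq e c -> a \in c ->
    {in c &, forall u v, e u v -> v = next c u \/ u = next c v} ->
  exists I J : {set T},
    [/\ independent e I /\ independent e J,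
        #|I|.*2.+1 = size c /\ #|J|.*2.+1 = size c, [disjoint I & J] &
        I :|: J = [set x in c] :\ a].
Proof.
move=> oc ac chord; have [cyc_c uniq_c size_c odd_c] := oc.
have [i s def_c] := rot_to ac.
have mem_c x : (x \in c) = (x == a) || (x \in s) by rewrite -(mem_rot i) def_c inE.
move: (uniq_c) odd_c; rewrite -(rot_uniq i) -(size_rot i) def_c /= => /andP[aNs uniq_s] even_s.
have index_next x y : x \in s -> y \in s -> y = next c x -> index y s = (index x s).+1.
  move=> xs ys; rewrite -(next_rot i) // def_c next_nth inE xs orbT /=.
  case: eqVneq => [ax|_]; first by rewrite ax xs in aNs.
  move=> def_y; move: ys; rewrite {}def_y.
  by case: (ltnP (index x s).+1 (size s)) => le_s ys;
    [rewrite index_uniq | rewrite nth_default // in ys; rewrite ys in aNs].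
pose P b := [set x in s | odd (index x s) == b].
have indP b : independent e (P b).
  apply/independentP=> x y; rewrite !inE => /andP[xs /eqP ox] /andP[ys /eqP oy] exy.
  have [xc yc] : x \in c /\ y \in c by rewrite !mem_c xs ys !orbT.
  case: (chord x y xc yc exy) => [/(index_next x y xs ys)|/(index_next y x ys xs)] def_i.
    by move: oy; rewrite def_i /= ox; case: (b).
  by move: ox; rewrite def_i /= oy; case: (b).
have disP : [disjoint P false & P true].
  by apply/pred0P=> x /=; rewrite !inE; case: (odd _); rewrite !andbF.
have UP : P false :|: P true = [set x in c] :\ a.
  apply/setP=> x; rewrite !inE mem_c.
  by case: (eqVneq x a) => [->|_];
    [rewrite (negPf aNs) | case: (odd _); rewrite ?andbF ?andbT ?orbF].
have size_s : size c = (size s).+1 by rewrite -(size_rot i) def_c.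
have leP b : #|P b|.*2 <= size s.
  have := independent_cycle oc (indP b); rewrite size_s ltnS.
  suff /setIidPl-> : P b \subset [set x in c] by [].
  by apply/subsetP=> x; rewrite !inE mem_c => /andP[-> _]; rewrite orbT.
have := cardsU (P false) (P true); rewrite disjoint_setI0 // cards0 subn0 UP.
have := cardsD1 a [set x in c]; rewrite inE ac.
have -> : #|[set x in c]| = size c by rewrite cardsE; apply/card_uniqP.
move=> cardD card2; exists (P false), (P true); split=> //.
move: cardD (leP false) (leP true); rewrite size_s card2 add1n => -[->].
by move: #|P false| #|P true| => m n; split; lia.
Qed.

End Alternating.

(** * Two odd cycles joined by an even path: bipartition, independence number and core *)

Section EvenLink.

Variables (T : finType) (e : rel T).
Hypotheses (e_sym : symmetric e) (e_irr : irreflexive e).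

Lemma reach_path (U : {set T}) s b v p :
    s \in U -> v \in reach e U s b -> path e v p -> {subset p <= U} ->
  last v p \in reach e U s (b (+) odd (size p)).
Proof.
move=> sU; elim: p v b => [|w p IHp] v b vb /=; first by rewrite addbF.
case/andP=> evw ep sub_p; rewrite addbN -addNb; apply: IHp ep _.
  by apply: reach_step vb _ evw => //; apply: sub_p; rewrite inE eqxx.
by move=> z zp; apply: sub_p; rewrite inE zp orbT.
Qed.

Lemma independentU (S R : {set T}) :
    independent e S -> independent e R ->
    (forall x y, x \in S -> y \in R -> e x y -> False) ->
  independent e (S :|: R).
Proof.
move=> /independentP iS /independentP iR SR; apply/independentP=> x y.
case/setUP=> [xS|xR] /setUP[yS|yR]; [exact: iS | exact: SR | | exact: iR].
by rewrite e_sym; apply: SR.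
Qed.

Lemma two_bicritical_bound (S : {set T}) :
  two_bicritical e -> 0 < #|T| -> independent e S -> (#|S|).*2 < #|T|.
Proof.
move=> bicrit T_gt0 indS; have [->|S0] := eqVneq S set0; first by rewrite cards0.
have sub : nbhd e S \subset ~: S.
  apply: nbhd_sub => x y xS exy; rewrite inE; apply/negP=> yS.
  by move/independentP: indS => /(_ x y xS yS exy).
rewrite -(cardsC S) -addnn ltn_add2l.
exact: leq_trans (bicrit S S0 indS) (subset_leq_card sub).
Qed.

Lemma card_split4 (C1 C2 C3 C4 S : {set T}) :
    (forall x, (x \in C1) + (x \in C2) + (x \in C3) + (x \in C4) = 1) ->
  #|S| = #|S :&: C1| + #|S :&: C2| + #|S :&: C3| + #|S :&: C4|.
Proof.
move=> part.
have cardI (D : {set T}) : #|S :&: D| = \sum_(x in S) (x \in D).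
  rewrite -sum1_card (eq_bigl (fun x => (x \in S) && (x \in D))); last by move=> x; rewrite inE.
  by rewrite big_mkcondr; apply: eq_bigr => x _; case: (x \in D).
by rewrite !cardI -!big_split -sum1_card; apply: eq_bigr => x _; rewrite /= part.
Qed.

(** Supplies the vertex [p1] needed to analyse the attachment of [c]: the last vertex before [a] on
    the linking path. Reversing the path gives the same for [c']. *)
Lemma link_end (c c' q : seq T) a a' :
    cycle e c' -> {in c', forall x, x \notin c} -> a' \in c' ->
    path e a' (rcons q a) -> {in q, forall x, x \notin c} ->
  [/\ last a' q \notin c, e a (last a' q) &
      {in c', forall w, connect (avoid e c) (last a' q) w}].
Proof.
move=> cyc_c' dis a'c'; rewrite rcons_path => /andP[eq eqa] qc.
have a'qc : {in a' :: q, forall x, x \notin c}.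
  by move=> x; rewrite inE => /predU1P[->|/qc //]; apply: dis.
split=> [||w wc']; first by apply: a'qc; apply: mem_last.
  by rewrite e_sym.
apply: (@connect_trans _ _ a').
  by rewrite avoid_sym //; apply/connectP; exists q => //; apply: path_avoid.
have cyc : cycle (avoid e c) c'.
  apply: (sub_in_cycle (P := mem c')) cyc_c' => [x y xc' yc' exy|]; last exact/allP.
  by apply/and3P; split=> //; apply: dis.
exact: (connect_cycle cyc).
Qed.

Variables (c c' q : seq T) (a a' : T).
Hypotheses (odd_c : odd_cycle_seq e c) (odd_c' : odd_cycle_seq e c').
Hypothesis dis_c : {in c, forall x, x \notin c'}.
Hypothesis two_cycles : forall d, odd_cycle_seq e d -> d =i c \/ d =i c'.
Hypotheses (ac : a \in c) (a'c' : a' \in c').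
Hypotheses (path_q : path e a' (rcons q a)) (odd_q : odd (size q)).
Hypothesis q_out : {in q, forall x, (x \notin c) && (x \notin c')}.
Hypotheses (conn : connected_graph e) (bicrit : two_bicritical e).

Let W := [set x in c] :|: [set x in c'].
Let X := [set x in W | degree e x == 2].

Lemma even_link_structure : exists A B : {set T},
  [/\ bipartition e (~: X) A B, #|A| = #|B| + 1, core e = B,
      #|T| = (alpha e).*2.+1 & #|B|.*2 + #|W| = #|T|.+1].
Proof.
have [cyc_c uniq_c _ _] := odd_c; have [cyc_c' uniq_c' _ _] := odd_c'.
have dis_c' : {in c', forall x, x \notin c}.
  by move=> x xc'; apply/negP=> /dis_c; rewrite xc'.
have two_cycles' d : odd_cycle_seq e d -> d =i c' \/ d =i c.
  by case/two_cycles; [right | left].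
have path_q' : path e a (rcons (rev q) a').
  have := rev_path e a' (rcons q a).
  rewrite last_rcons belast_rcons rev_cons => ->.
  by rewrite (@eq_path _ _ e) // => x y; apply: e_sym.
have qc x : x \in q -> x \notin c by case/q_out/andP.
have qc' x : x \in rev q -> x \notin c' by rewrite mem_rev => /q_out/andP[].
have [p1c eap1 conn_c'] := link_end cyc_c' dis_c' a'c' path_q qc.
have [p1c' eap1' conn_c] := link_end cyc_c dis_c ac path_q' qc'.
have deg_c := degree_cycle e_sym e_irr odd_c odd_c' dis_c two_cycles ac p1c eap1 conn_c' bicrit.
have deg_c' := degree_cycle e_sym e_irr odd_c' odd_c dis_c' two_cycles'
  a'c' p1c' eap1' conn_c bicrit.
have nb_c x y : x \in c -> x != a -> e x y -> y \in c.
  exact: (cycle_nbhd e_sym e_irr odd_c odd_c' dis_c two_cycles ac eap1 conn_c' bicrit).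
have nb_c' x y : x \in c' -> x != a' -> e x y -> y \in c'.
  exact: (cycle_nbhd e_sym e_irr odd_c' odd_c dis_c' two_cycles' a'c' eap1' conn_c bicrit).
have memX x : (x \in X) = (x \in c) && (x != a) || (x \in c') && (x != a').
  rewrite !inE; case: (boolP (x \in c)) => [xc | _] /=.
    by rewrite (negPf (dis_c xc)) deg_c ?orbF.
  by case: (boolP (x \in c')) => [xc' | _] //=; rewrite deg_c'.
pose U := ~: X.
have Uc x : x \in U -> x \in c -> x = a.
  by rewrite inE memX => + xc; rewrite xc /=; case: eqVneq.
have Uc' x : x \in U -> x \in c' -> x = a'.
  by rewrite inE memX => + xc; rewrite xc /= orbC; case: eqVneq.
have aU : a \in U by rewrite inE memX eqxx (negPf (dis_c ac)) andbF.
have a'U : a' \in U by rewrite inE memX eqxx (negPf (dis_c' _ a'c')) andbF.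
have noodd d : odd_cycle_seq e d -> {subset d <= U} -> False.
  move=> od dU; case: (two_cycles od) => def_d.
    have nac : next c a \in c by rewrite mem_next.
    have naE : next c a = a by apply: Uc => //; apply: dU; rewrite def_d.
    by have := next_cycle cyc_c ac; rewrite naE e_irr.
  have nac : next c' a' \in c' by rewrite mem_next.
  have naE : next c' a' = a' by apply: Uc' => //; apply: dU; rewrite def_d.
  by have := next_cycle cyc_c' a'c'; rewrite naE e_irr.
have disAB := reach_disjoint e_sym e_irr aU noodd.
pose A := reach e U a false; pose B := reach e U a true.
have indA : independent e A := reach_indep false aU disAB.
have indB : independent e B := reach_indep true aU disAB.
have AU : A \subset U by apply: reach_sub.
have BU : B \subset U by apply: reach_sub.
have aA : a \in A by apply: reach0.
have qU : {subset rev q <= U}.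
  by move=> x; rewrite mem_rev => /q_out/andP[xc xc']; rewrite inE memX (negPf xc) (negPf xc').
(* The evenness of the linking path enters here: it puts [a'] in the same class as [a]. *)
have a'A : a' \in A.
  have := reach_path aU aA path_q'; rewrite last_rcons size_rcons size_rev /= odd_q; apply.
  by move=> x; rewrite mem_rcons inE => /predU1P[-> // | /qU].
have edgeU x y : x \in U -> x != a -> x != a' -> e x y -> y \in U.
  move=> xU xa xa' exy; rewrite inE memX; apply/negP.
  case/orP=> /andP[yc ya]; [case/negP: xa | case/negP: xa']; apply/eqP.
    by apply: Uc => //; apply: nb_c yc ya _; rewrite e_sym.
  by apply: Uc' => //; apply: nb_c' yc ya _; rewrite e_sym.
have ABU : A :|: B = U.
  (* A walk from [a] to [x] may pass through [X], but it can return to [U] only at [a] or [a'], both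
     in [A]; so it never leaves [A :|: B :|: X]. *)
  apply/eqP; rewrite eqEsubset subUset AU BU; apply/subsetP=> x xU.
  suff: x \in (A :|: B) :|: X by move: xU; rewrite inE => /negPf xX; rewrite inE xX orbF.
  apply: (@connect_inv _ e (fun v => v \in A :|: B :|: X) a x _ _ (conn a x));
    last by rewrite !inE connect0.
  move=> u v euv; case: (boolP (v \in X)) => vX; first by rewrite !(inE, vX) orbT.
  have vU : v \in U by rewrite inE.
  move=> uABX; rewrite inE; apply/orP; left; apply/setUP.
  case/setUP: uABX => [/setUP[uA|uB]|].
  - by right; apply: reach_step uA vU euv.
  - by left; apply: reach_step uB vU euv.
  rewrite memX => /orP[]/andP[uc ua]; left.
    by rewrite (Uc v vU) // (nb_c u v).
  by rewrite (Uc' v vU) // (nb_c' u v).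
have notA x : x \in B -> x \notin A by move=> xB; rewrite (disjointFl disAB xB).
have nbB x y : x \in B -> e x y -> y \in A.
  move=> xB exy; apply: (reach_step aU xB) => //; apply: edgeU exy.
  - exact: (subsetP BU).
  - by apply: contraNneq (notA x xB) => ->.
  - by apply: contraNneq (notA x xB) => ->.
(* Removing [a] and [a'], the only vertices of [U] with neighbours in [X], leaves a set whose
   neighbours all lie in [B]. *)
pose A0 := A :\ a :\ a'.
have nbA0 x y : x \in A0 -> e x y -> y \in B.
  case/setD1P=> xa' /setD1P[xa xA] exy; apply: (reach_step aU xA) => //.
  by apply: edgeU exy => //; apply: (subsetP AU).
have indA0 : independent e A0.
  by apply: independentS indA; apply: subset_trans (subsetDl _ _) (subsetDl _ _).
have a'a : a' != a by apply: contraTneq a'c' => ->; apply: dis_c.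
have cardA : #|A| = #|A0|.+2.
  have a'A1 : a' \in A :\ a by rewrite in_setD1 a'a.
  by rewrite (cardsD1 a A) aA (cardsD1 a' (A :\ a)) a'A1.
have [b bB] : exists b, b \in B.
  exists (last a' q); apply: (reach_step aU aA) => //.
  by have := mem_last a' q; rewrite inE => /predU1P[-> // | lq]; apply: qU; rewrite mem_rev.
have ltBA : #|B| < #|A|.
  apply: leq_trans (bicrit _ indB) _; first by apply/set0Pn; exists b.
  by apply/subset_leq_card/nbhd_sub.
have ltA0B : #|A0| < #|B|.
  have [->|A00] := eqVneq A0 set0; first by rewrite cards0; apply/card_gt0P; exists b.
  apply: leq_trans (bicrit A00 indA0) _.
  by apply/subset_leq_card/nbhd_sub.
have cardB : #|B| = #|A0|.+1 by apply/eqP; rewrite eqn_leq ltA0B andbT -ltnS -cardA.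
pose C := [set x in c]; pose C' := [set x in c'].
(* The two full cycles, [A0] and [B] partition the vertices; [a] and [a'] are counted with their
   cycles. *)
have part x : (x \in C) + (x \in C') + (x \in A0) + (x \in B) = 1.
  have ->: (x \in A0) = [&& x != a', x != a & x \in A] by rewrite !in_setD1.
  rewrite [x \in C]inE [x \in C']inE.
  case: (boolP (x \in U)) => [xU | xU]; last first.
    rewrite (contraNF (subsetP AU x) xU) (contraNF (subsetP BU x) xU) !andbF !addn0.
    move: xU; rewrite inE negbK memX.
    by case/orP=> /andP[xc _]; [have := dis_c xc | have := dis_c' _ xc]; rewrite xc => /negPf->.
  have AB : (x \in A) + (x \in B) = 1.
    move: (xU); rewrite -ABU => /setUP[xA|xB].
      by rewrite xA (disjointFr disAB xA).
    by rewrite xB (disjointFl disAB xB).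
  case: (boolP (x \in c)) => [xc | xc].
    have xE := Uc x xU xc; move: AB; rewrite (negPf (dis_c xc)) xE eqxx aA andbF.
    by case: (a \in B).
  case: (boolP (x \in c')) => [xc' | xc'].
    by have xE := Uc' x xU xc'; move: AB; rewrite xE eqxx a'A; case: (a' \in B).
  have -> : x != a' by apply: contraNneq xc' => ->.
  by have -> : x != a by apply: contraNneq xc => ->.
have cardS S := card_split4 S part.
have cardC : #|C| = size c by rewrite cardsE; apply/card_uniqP.
have cardC' : #|C'| = size c' by rewrite cardsE; apply/card_uniqP.
have cardT : #|T| = size c + size c' + #|A0| + #|B|.
  by rewrite -cardsT (cardS [set: T]) !setTI cardC cardC'.
have T_gt0 : 0 < #|T| by apply/card_gt0P; exists a.
have chord_c : {in c &, forall u v, e u v -> v = next c u \/ u = next c v}.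
  by move=> u v; apply: (no_chord e_sym e_irr odd_c dis_c two_cycles).
have chord_c' : {in c' &, forall u v, e u v -> v = next c' u \/ u = next c' v}.
  by move=> u v; apply: (no_chord e_sym e_irr odd_c' dis_c' two_cycles').
have [I [J [[indI indJ] [cardI cardJ] disIJ IJ]]] := alternating_cycle odd_c ac chord_c.
have [I' [J' [[indI' indJ'] [cardI' cardJ'] disIJ' IJ']]] := alternating_cycle odd_c' a'c' chord_c'.
have IC x : x \in I -> (x \in c) && (x != a).
  by move=> xI; have: x \in I :|: J by [rewrite inE xI]; rewrite IJ !inE andbC.
have JC x : x \in J -> (x \in c) && (x != a).
  by move=> xJ; have: x \in I :|: J by [rewrite inE xJ orbT]; rewrite IJ !inE andbC.
have IC' x : x \in I' -> (x \in c') && (x != a').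
  by move=> xI; have: x \in I' :|: J' by [rewrite inE xI]; rewrite IJ' !inE andbC.
have JC' x : x \in J' -> (x \in c') && (x != a').
  by move=> xJ; have: x \in I' :|: J' by [rewrite inE xJ orbT]; rewrite IJ' !inE andbC.
have maxi (K K' : {set T}) : independent e K -> independent e K' ->
    (forall x, x \in K -> (x \in c) && (x != a)) ->
    (forall x, x \in K' -> (x \in c') && (x != a')) ->
    independent e (B :|: (K :|: K')) /\ #|B :|: (K :|: K')| = #|B| + #|K| + #|K'|.
  move=> indK indK' KC KC'; split.
    apply: independentU => // [|x y xB yK /(nbB _ _ xB)/(subsetP AU)].
      apply: independentU => // x y /KC/andP[xc xa] /KC'/andP[yc' _] exy.
      by have := dis_c' _ yc'; rewrite (nb_c x y).
    rewrite inE memX => /negP; apply.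
    by case/setUP: yK => [/KC->|/KC'->]; rewrite ?orbT.
  rewrite cardsU (cardsU K) !disjoint_setI0 ?cards0 ?subn0 ?addnA //.
    apply/pred0P=> x /=; apply/negP=> /andP[/(subsetP BU)].
    by rewrite inE memX => /negP xB /setUP[/KC xK|/KC' xK]; apply: xB; rewrite xK ?orbT.
  apply/pred0P=> x /=; apply/negP=> /andP[/KC/andP[xc _] /KC'/andP[xc' _]].
  by have := dis_c xc; rewrite xc'.
have [indM cardM] := maxi I I' indI indI' IC IC'.
have [indN cardN] := maxi J J' indJ indJ' JC JC'.
have cardTM : #|T| = #|B :|: (I :|: I')|.*2.+1.
  rewrite cardT cardM -cardI -cardI' cardB !doubleD doubleS -!addnn.
  by move: #|A0| #|I| #|I'|; clear; lia.
have alphaE : alpha e = #|B :|: (I :|: I')|.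
  apply/eqP; rewrite eqn_leq; apply/andP; split.
    apply/bigmax_leqP=> S indS; rewrite -leq_double -ltnS -cardTM.
    exact: two_bicritical_bound.
  exact: (leq_bigmax_cond (F := fun S : {set T} => #|S|) _ indM).
exists A, B; split.
- by split=> //; rewrite indA indB.
- by rewrite cardA cardB addn1.
- apply/eqP; rewrite eqEsubset; apply/andP; split.
    have coreS S : independent e S -> #|S| = alpha e -> {subset core e <= S}.
      by move=> indS /eqP cS; apply/subsetP/bigcap_inf; rewrite indS.
    apply/subsetP=> x xcore; have := coreS _ indM (esym alphaE) x xcore.
    have /coreS/(_ x xcore) : #|B :|: (J :|: J')| = alpha e.
      rewrite alphaE cardN cardM; move: cardI cardI' cardJ cardJ' => <- <- [/double_inj->].
      by case=> /double_inj->.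
    move/(_ indN); rewrite !in_setU; case: (x \in B) => //=.
    case/orP=> [xJ|xJ'] /orP[xI|xI'].
    + by rewrite (disjointFr disIJ xI) in xJ.
    + by case/andP: (JC x xJ) => /dis_c; case/andP: (IC' x xI') => ->.
    + by case/andP: (JC' x xJ') => /dis_c'; case/andP: (IC x xI) => ->.
    + by rewrite (disjointFr disIJ' xI') in xJ'.
  apply/bigcapsP=> S /andP[indS /eqP cardSa].
  have leC : #|S :&: C| <= #|I|.
    by have := independent_cycle odd_c indS; rewrite -cardI ltnS leq_double.
  have leC' : #|S :&: C'| <= #|I'|.
    by have := independent_cycle odd_c' indS; rewrite -cardI' ltnS leq_double.
  (* A maximum [S] has [#|B| + #|I| + #|I'|] vertices, of which the cycles hold at most
     [#|I| + #|I'|]. *)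
  have leB : #|B| <= #|S :&: A0| + #|S :&: B|.
    move: cardSa; rewrite alphaE cardM (cardS S).
    move: #|S :&: C| #|S :&: C'| #|S :&: A0| #|S :&: B| #|B| #|I| #|I'| leC leC'.
    by clear; lia.
  have SA0 : S :&: A0 = set0.
    apply: contraTeq leB => SA0_neq0; rewrite -ltnNge.
    have indSA : independent e (S :&: A0) by apply: independentS indS; apply: subsetIl.
    rewrite -(cardsID S B) [B :&: S]setIC addnC ltn_add2l.
    apply: leq_trans (bicrit SA0_neq0 indSA) _.
    apply/subset_leq_card/nbhd_sub => x y /setIP[xS xA0] exy.
    rewrite inE (nbA0 x y) // andbT; apply/negP=> yS.
    by move/independentP: indS => /(_ x y xS yS exy).
  rewrite SA0 cards0 add0n in leB.
  have /eqP <- : S :&: B == B by rewrite eqEcard subsetIr.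
  exact: subsetIl.
- by rewrite alphaE.
have cardW : #|W| = size c + size c'.
  rewrite /W cardsU -/C -/C' cardC cardC' disjoint_setI0 ?cards0 ?subn0 //.
  by apply/pred0P=> x /=; rewrite !inE; apply/negP=> /andP[/dis_c/negP].
by rewrite cardW cardT cardB; move: #|A0| (size c) (size c'); clear; lia.
Qed.

End EvenLink.

(** * From the ear construction to the two linked cycles *)

Theorem theorem4p4 (T : finType) (e : rel T)
  (e_sym : symmetric e) (e_irr : irreflexive e)
  (hG : even_linked e)
  (C C' : subgraph T)
  (hC : odd_cycle e C) (hC' : odd_cycle e C') (hCC' : C <> C') :
  let n := #|T| in
  let W := vertices C :|: vertices C' in
  let X := [set x in W | degree e x == 2] in
  exists A B : {set T},
    [/\ bipartition e (~: X) A B,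
        #|A| = #|B| + 1,
        core e = B,
        ((alpha e)%:R = (n%:R - 1) / 2 :> rat)%R &
        (#|core e|%:R = (n%:R - #|W|%:R + 1) / 2 :> rat)%R].
Proof.
move=> n W X; case: hG => conn bicrit [C1 [C2 [_ two]]].
case=> p [Gs [_ oG0 [D [a' [q [a [[oD dis [path_q _] [a'D aG0] q_out] even_q _]]]]] _ _]].
have G0D : Gs 0 <> D.
  by move=> eqGD; have := disjointFr dis a'D; rewrite eqGD a'D.
(* The initial cycle and the cycle of the pendant are distinct odd cycles, hence the only two; so
   they are [C] and [C'] in some order. *)
have two_cycles E : odd_cycle e E -> E = Gs 0 \/ E = D.
  have [/two G0E _] := (oG0, oD); have /two DE := oD.
  by case: G0E DE G0D => -> [] -> // _ /two[]->; auto.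
have WE : W = vertices (Gs 0) :|: vertices D.
  rewrite /W; case: (two_cycles C hC) (two_cycles C' hC') hCC' => -> [] -> // _.
  by rewrite setUC.
have [c oc G0E] := oG0; have [c' oc' DE] := oD.
rewrite G0E DE /= in WE dis a'D aG0 q_out; rewrite !inE in a'D aG0.
have dis_c : {in c, forall x, x \notin c'}.
  by move=> x xc; apply/negP=> xc'; have := disjointFl dis (x := x); rewrite !inE xc' => /(_ xc).
have [|||A [B [bip cardA coreE cardT cardW]]] :=
  even_link_structure e_sym e_irr oc oc' dis_c _ aG0 a'D path_q _ _ conn bicrit.
- move=> d od; have /two_cycles[] : odd_cycle e (cycle_subgraph d) by exists d.
    by rewrite G0E => /(congr1 (@vertices T)) /setP eq_d; left=> x; have := eq_d x; rewrite !inE.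
  by rewrite DE => /(congr1 (@vertices T)) /setP eq_d; right=> x; have := eq_d x; rewrite !inE.
- by move: even_q; rewrite size_rcons /= negbK.
- by move=> x /q_out; rewrite !inE.
exists A, B; split; rewrite ?coreE //; first by rewrite /X WE.
  rewrite /n cardT -GRing.natr1 GRing.addrK -muln2 GRing.natrM GRing.mulfK //.
have -> : (n%:R - #|W|%:R + 1 = #|B|%:R * 2 :> rat)%R; last by rewrite GRing.mulfK.
rewrite GRing.addrAC GRing.natr1 -cardW WE -muln2 GRing.natrD GRing.addrK.
by rewrite GRing.natrM.
Qed.
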